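(* Let $p$ be an odd positive integer and let $a,b$ be integers with $1\le a<b\le\lfloor\frac{3p-1}{2}\rfloor$, $\gcd(a,b)=1$, and $\frac{3p}{\gcd(3p,b)}=3s$ for some positive integer $s$. Then the circulant graph $C_{3p}(a,b)$ is Type I, i.e. its total chromatic number equals $5$.
   Context: For integers $n$ and $1\le d_1<d_2<\dots<d_l\le\lfloor n/2\rfloor$, the circulant graph $C_n(d_1,\dots,d_l)$ has vertex set $\{0,1,\dots,n-1\}$, with $x$ and $y$ adjacent iff $x\equiv y\pm d_i \pmod n$ for some $i$. The paper considers four-regular circulant graphs $C_n(a,b)$ with $1\le a<b\le\lfloor\frac{n-1}{2}\rfloor$. A total coloring of a graph $G$ assigns colors to vertices and edges so that adjacent vertices receive different colors, edges sharing an endpoint receive different colors, and each edge receives a color different from its two endpoints. The total chromatic number $\chi''(G)$ is the minimum number of colors in a total coloring; always $\chi''(G)\ge\Delta(G)+1$. A graph is Type I if $\chi''(G)=\Delta(G)+1$. *)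

(* Defs.v *)
From HB Require Import structures.
From mathcomp Require Import all_boot.
Set Implicit Arguments.
Unset Strict Implicit.
Unset Printing Implicit Defensive.

Record sgraph := SGraph {
  vertex :> finType;
  adj : rel vertex;
  adj_sym : symmetric adj;
  adj_irrefl : irreflexive adj }.

Section TotalColoring.
Variable G : sgraph.

Definition edges : {set {set G}} := [set [set x; y] | x in G, y in G & adj x y].

Definition max_degree : nat := \max_(x : G) #|[set y | adj x y]|.

(* The objects to be colored are the vertices and the edges. *)
Definition element : finType := (G + {E : {set G} | E \in edges})%type.

Definition conflict (u v : element) : bool :=
  match u, v with
  | inl x, inl y => adj x y
  | inl x, inr E | inr E, inl x => x \in val E
  | inr E, inr F => (E != F) && (val E :&: val F != set0)
  end.

Definition total_coloring (k : nat) (c : {ffun element -> 'I_k}) : bool :=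
  [forall u, forall v, conflict u v ==> (c u != c v)].

Definition total_colorable (k : nat) : bool :=
  [exists c : {ffun element -> 'I_k}, total_coloring c].

Lemma exists_total_colorable : exists k, total_colorable k.
Proof.
exists #|element|; apply/existsP; exists [ffun u => enum_rank u].
apply/forallP=> u; apply/forallP=> v; apply/implyP=> uv.
rewrite !ffunE (inj_eq enum_rank_inj); apply: contraTneq uv => ->.
by case: v => [x|E] /=; rewrite ?adj_irrefl ?eqxx.
Qed.

Definition total_chromatic_number : nat := ex_minn exists_total_colorable.

Definition type_I : Prop := total_chromatic_number = max_degree.+1.

End TotalColoring.

Section Circulant.
Variables (n : nat) (ds : seq nat).

(* [x + d == y %[mod n]] is x = y - d modulo n, avoiding truncated subtraction.
   The conjunct [x != y] makes the graph loopless for arbitrary [ds]; it is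
   redundant when every d in [ds] satisfies 1 <= d <= n / 2. *)
Definition circulant_adj : rel 'I_n := fun x y =>
  (x != y) &&
  has (fun d => (x == y + d %[mod n]) || (x + d == y %[mod n])) ds.

Lemma circulant_adj_sym : symmetric circulant_adj.
Proof.
move=> x y; rewrite /circulant_adj eq_sym; congr (_ && _).
by apply: eq_has => d /=; rewrite orbC eq_sym [X in _ || X]eq_sym.
Qed.

Lemma circulant_adj_irrefl : irreflexive circulant_adj.
Proof. by move=> x; rewrite /circulant_adj eqxx. Qed.

Definition circulant : sgraph := SGraph circulant_adj_sym circulant_adj_irrefl.

End Circulant.

(* Main.v *)
(* Every vertex of a 4-regular graph sees all five colours of a total
   5-colouring.  Let n = 3p, g = gcd(n, b) and m = n / g, so that the b-edges form
   g cycles of length m, consecutive ones being joined by perfect matchings of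
   a-edges.  If g > 1, the columns (the b-cycles) can be coloured one after the
   other with period 3, starting and ending in the same state up to the twist by
   which the last column is glued to the first; three columns absorb any twist
   and two columns absorb none, which reaches every odd g >= 3.

   If g = 1, multiplying by the inverse of b turns the graph into C_n(c, 1).  If
   3 does not divide c, colour vertices and c-edges by 0, 1, 2 according to the
   residue modulo 3 and the 1-edges alternately by 3 and 4; as n is odd this
   fails at a single 1-edge, and two short Kempe chains repair it.  If 3 divides
   c, exchange the roles of c and 1: the number g' = gcd(n, c) of c-cycles is a
   multiple of 3.  When 3 divides their length m' the first argument applies.
   Otherwise each column is coloured with period 3 except near a seam, and three
   columns still absorb every twist t in Z/m': as blocks of three periodic rows
   can be inserted on either side of the seams, finitely many values of (m', t)
   suffice. *)
Require Import Defs.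
From mathcomp Require Import all_boot zify.
Set Implicit Arguments.
Unset Strict Implicit.
Unset Printing Implicit Defensive.

(** * Columns and states *)

(* A column is a function from row numbers to codes 25 v + 5 f + u, where v is the
   colour of the vertex in this row, f the colour of the edge to the next row of
   the same column, and u the colour of the edge to the same row of the next
   column.  Only v and u, the state, matter to the next column. *)
Definition vcol k := k %/ 25 %% 5.
Definition fcol k := k %/ 5 %% 5.
Definition ucol k := k %% 5.

Definition same_state k l := (vcol k == vcol l) && (ucol k == ucol l).

(* Correctness of column [d], preceded by [c], in row [z] that follows row [y]. *)
Definition link (c d : nat -> nat) y z :=
  [&& uniq [:: vcol (d z); fcol (d y); fcol (d z); ucol (c z); ucol (d z)],
      vcol (d y) != vcol (d z) & vcol (c z) != vcol (d z)].

Definition step m c d := all (fun y => link c d y (y.+1 %% m)) (iota 0 m).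

Fixpoint chain m c l :=
  if l is d :: l' then step m c d && chain m d l' else true.

(* Rows y0, y0 + 1, y0 + 2 may be repeated. *)
Fixpoint loops y0 c l :=
  if l is d :: l' then link c d (y0 + 2) y0 && loops y0 d l' else true.

Definition agrees m (c d : nat -> nat) :=
  all (fun y => same_state (c y) (d y)) (iota 0 m).

Lemma agreesP m c d :
  reflect (forall y, y < m -> same_state (c y) (d y)) (agrees m c d).
Proof.
apply: (iffP allP) => [H y lt_ym|H y]; first by apply: H; rewrite mem_iota.
by rewrite mem_iota => /H.
Qed.

Lemma stepP m c d :
  reflect (forall y, y < m -> link c d y (y.+1 %% m)) (step m c d).
Proof.
apply: (iffP allP) => [H y lt_ym|H y]; first by apply: H; rewrite mem_iota.
by rewrite mem_iota => /H.
Qed.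

Lemma same_state_sym : symmetric same_state.
Proof. by move=> k l; rewrite /same_state [vcol l == _]eq_sym [ucol l == _]eq_sym. Qed.

Lemma same_state_trans : transitive same_state.
Proof.
by move=> l k j /andP[/eqP Hv /eqP Hu]; rewrite /same_state Hv Hu.
Qed.

Lemma agrees_sym m c d : agrees m c d = agrees m d c.
Proof. by apply: eq_all => y; rewrite same_state_sym. Qed.

Lemma agrees_trans m d c e : agrees m c d -> agrees m d e -> agrees m c e.
Proof.
move=> /agreesP Hcd /agreesP Hde; apply/agreesP => y lt_ym.
by apply: same_state_trans (Hcd y lt_ym) (Hde y lt_ym).
Qed.

Lemma link_agrees c c' d y z :
  same_state (c z) (c' z) -> link c d y z = link c' d y z.
Proof. by case/andP=> /eqP Hv /eqP Hu; rewrite /link Hv Hu. Qed.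

Lemma step_agrees m c c' d : agrees m c c' -> step m c d = step m c' d.
Proof.
move=> /agreesP Hc; apply: eq_in_all => y; rewrite mem_iota => lt_ym.
by apply/link_agrees/Hc; rewrite ltn_mod; lia.
Qed.

Lemma chain_agrees m c c' l : agrees m c c' -> chain m c l = chain m c' l.
Proof. by case: l => //= d l /step_agrees->. Qed.

(** * Lengthening columns by three periodic rows *)

(* Inserts a second copy of rows y0, y0 + 1, y0 + 2 after the first one. *)
Definition stretch y0 (c : nat -> nat) y := c (if y < y0 + 3 then y else y - 3).

Lemma stretch_lt y0 c y : y < y0 + 3 -> stretch y0 c y = c y.
Proof. by rewrite /stretch => ->. Qed.

Lemma stretch_ge y0 c y : y0 + 3 <= y -> stretch y0 c y = c (y - 3).
Proof. by rewrite /stretch leqNgt => /negbTE->. Qed.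

Lemma eq_link c c' d d' y y' z z' :
  c z = c' z' -> d y = d' y' -> d z = d' z' -> link c d y z = link c' d' y' z'.
Proof. by rewrite /link => -> -> ->. Qed.

(** The only new pair of consecutive rows is [y0 + 2] followed by a copy of [y0]; every other pair
    already occurs in the original columns. *)
Lemma step_stretch m y0 c d : y0 + 3 <= m ->
  step m c d -> link c d (y0 + 2) y0 ->
  step (m + 3) (stretch y0 c) (stretch y0 d).
Proof.
move=> le_y0m /stepP Hs Hl; apply/stepP => y lt_ym.
have [lt_y|ge_y] := ltnP y (y0 + 2).
  have := Hs y ltac:(lia); rewrite !modn_small; [|lia..].
  by rewrite (@eq_link _ (stretch y0 c) _ (stretch y0 d) _ y _ y.+1) // stretch_lt //; lia.
have [->|ne_y] := eqVneq y (y0 + 2).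
  rewrite modn_small; last lia.
  rewrite (@eq_link _ c _ d _ (y0 + 2) _ y0) //.
  - rewrite stretch_ge; last lia; congr c; lia.
  - by rewrite stretch_lt //; lia.
  - rewrite stretch_ge; last lia; congr d; lia.
have := Hs (y - 3) ltac:(lia).
have [->|ne_ym] := eqVneq y (m + 2).
  have -> : (m + 2).+1 %% (m + 3) = 0 by rewrite -addn1 -addnA modnn.
  have -> : (m + 2 - 3).+1 %% m = 0.
    rewrite (_ : (m + 2 - 3).+1 = m); last lia; by rewrite modnn.
  rewrite (@eq_link _ (stretch y0 c) _ (stretch y0 d) _ (m + 2) _ 0) //.
  - by rewrite stretch_lt //; lia.
  - by rewrite stretch_ge //; lia.
  - by rewrite stretch_lt //; lia.
rewrite !modn_small; [|lia..].
rewrite (@eq_link _ (stretch y0 c) _ (stretch y0 d) _ y _ y.+1) //.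
- rewrite stretch_ge; last lia; congr c; lia.
- by rewrite stretch_ge //; lia.
- rewrite stretch_ge; last lia; congr d; lia.
Qed.

Lemma chain_stretch m y0 c l : y0 + 3 <= m ->
  chain m c l -> loops y0 c l ->
  chain (m + 3) (stretch y0 c) (map (stretch y0) l).
Proof.
move=> le_y0m; elim: l c => //= d l IHl c /andP[Hs Hc] /andP[Hl Hls].
by rewrite step_stretch //= IHl.
Qed.

(** The insertion leaves the rows up to [y0 + 2] in place, so a loop starting no later than [y0]
    stays available. *)
Lemma loops_stretch y1 y0 c l : y1 <= y0 ->
  loops y1 (stretch y0 c) (map (stretch y0) l) = loops y1 c l.
Proof.
move=> le_y; elim: l c => //= d l IHl c; rewrite {}IHl; congr (_ && _).
by rewrite (@eq_link _ c _ d _ (y1 + 2) _ y1) // stretch_lt //; lia.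
Qed.

Lemma loops_agrees y0 c c' l :
  same_state (c y0) (c' y0) -> loops y0 c l = loops y0 c' l.
Proof. by case: l => //= d l Hc; rewrite (link_agrees d _ Hc). Qed.

(** * Twisted gluing of columns *)

Definition shifted S m t (y : nat) : nat := S ((y + (m - t)) %% m).

(* The columns [l], preceded by a column in state [S] moved up by [t] rows, end in
   state [S]: gluing with twist [t] closes them up to a torus. *)
Definition turn S m t l :=
  chain m (shifted S m t) l && agrees m (last (shifted S m t) l) S.

(* States with vertex colours 0, 3, 4 repeated and colour 2 on all edges to the
   next column, except on the seam [w]. *)
Definition bulk := [:: 2; 77; 102].
Definition seam w y :=
  if y < size w then nth 0 w y else nth 0 bulk ((y - size w) %% 3).

Lemma seam_add3 w y : size w <= y -> seam w (y + 3) = seam w y.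
Proof.
move=> le_wy; rewrite /seam !ifF; [|lia..].
rewrite (_ : y + 3 - size w = y - size w + 3); last lia; by rewrite modnDr.
Qed.

Lemma agrees_out w m y0 c : size w <= y0 -> y0 + 3 <= m ->
  agrees m c (seam w) -> agrees (m + 3) (stretch y0 c) (seam w).
Proof.
move=> le_wy le_ym /agreesP H; apply/agreesP => y lt_y; rewrite /stretch.
case: ifP => lt_yy0; first by apply: H; lia.
have -> : seam w y = seam w (y - 3).
  by rewrite -[RHS]seam_add3 ?subnK //; lia.
by apply: H; lia.
Qed.

Lemma shiftedE S m t y : t < m -> y < m ->
  shifted S m t y = S (if t <= y then y - t else y + m - t).
Proof.
move=> lt_tm lt_ym; rewrite /shifted; congr S; case: leqP => lt.
  rewrite (_ : y + (m - t) = y - t + m); last lia; by rewrite modnDr modn_small //; lia.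
by rewrite modn_small; lia.
Qed.

(** The moved seam ends before the insertion, so the twist is kept. Rows below [t] hold bulk wrapped
    around from the top, where adding 3 to the index changes nothing. *)
Lemma shifted_stretch_after w m t y0 : t < m -> t + size w <= y0 -> y0 + 3 <= m ->
  agrees (m + 3) (stretch y0 (shifted (seam w) m t)) (shifted (seam w) (m + 3) t).
Proof.
move=> lt_tm le_ty le_ym; apply/agreesP => y lt_y.
suff -> : stretch y0 (shifted (seam w) m t) y = shifted (seam w) (m + 3) t y.
  by rewrite /same_state !eqxx.
rewrite /stretch; case: ifP => lt_yy; rewrite !shiftedE; try lia.
  case: ifP => // lt_ty; have -> : y + (m + 3) - t = y + m - t + 3 by lia.
  by rewrite seam_add3 //; lia.
rewrite !ifT; [|lia..]; rewrite (_ : y - t = y - 3 - t + 3); last lia.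
by rewrite seam_add3 //; lia.
Qed.

(** Here the insertion precedes the moved seam and pushes it up by three rows, so [t] grows together
    with [m]. *)
Lemma shifted_stretch_before w m t y0 : t < m -> size w <= y0 -> y0 + 3 <= t ->
  agrees (m + 3) (stretch y0 (shifted (seam w) m t)) (shifted (seam w) (m + 3) (t + 3)).
Proof.
move=> lt_tm le_ty le_ym; apply/agreesP => y lt_y.
suff -> : stretch y0 (shifted (seam w) m t) y = shifted (seam w) (m + 3) (t + 3) y.
  by rewrite /same_state !eqxx.
rewrite /stretch; case: ifP => lt_yy; rewrite !shiftedE; try lia.
  by rewrite !ifF; [congr seam|..]; lia.
have [le_ty'|gt_ty] := leqP (t + 3) y.
  by rewrite ifT; [congr seam|]; lia.
rewrite ifF; last lia; have -> : y + (m + 3) - (t + 3) = y - 3 + m - t + 3 by lia.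
by rewrite seam_add3 //; lia.
Qed.

Lemma turn_stretch_after w m t y0 l : t < m -> t + size w <= y0 -> y0 + 3 <= m ->
  turn (seam w) m t l -> loops y0 (shifted (seam w) m t) l ->
  turn (seam w) (m + 3) t (map (stretch y0) l).
Proof.
move=> lt_tm le_ty le_ym /andP[Hc Ha] Hl.
have Hs := shifted_stretch_after lt_tm le_ty le_ym.
rewrite /turn -(chain_agrees _ Hs) chain_stretch //=.
case: l {Hc Hl} Ha => [|d l] /= Ha; last first.
  by rewrite last_map; apply: agrees_out => //; lia.
have {}Ha : agrees (m + 3) (stretch y0 (shifted (seam w) m t)) (seam w).
  by apply: agrees_out Ha; lia.
by apply: agrees_trans Ha; rewrite agrees_sym.
Qed.

Lemma turn_stretch_before w m t y0 l : t < m -> size w <= y0 -> y0 + 3 <= t ->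
  turn (seam w) m t l -> loops y0 (shifted (seam w) m t) l ->
  turn (seam w) (m + 3) (t + 3) (map (stretch y0) l).
Proof.
move=> lt_tm le_ty le_ym /andP[Hc Ha] Hl.
have Hs := shifted_stretch_before lt_tm le_ty le_ym.
rewrite /turn -(chain_agrees _ Hs) chain_stretch //=; last by lia.
case: l {Hc Hl} Ha => [|d l] /= Ha; last first.
  by rewrite last_map; apply: agrees_out => //; lia.
have {}Ha : agrees (m + 3) (stretch y0 (shifted (seam w) m t)) (seam w).
  by apply: agrees_out Ha; lia.
by apply: agrees_trans Ha; rewrite agrees_sym.
Qed.

(** * Tables *)

(* An entry (t, y1, y2, cs) lists three columns [cs] realising the twist [t] for
   columns of length m = size of the members of [cs].  The rows from y1, between
   the seam of the final state (at 0) and that of the initial state (at t), can be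
   repeated, increasing m and t by 3; the rows from y2, after both seams, can be
   repeated, increasing m by 3.  The tables were found by computer search. *)
Definition entry : Type := nat * option nat * option nat * seq (seq nat).

(** Vertex colours 0, 1, 2 and colour 3 on the edges to the next column. Used as a seam of full
    column length, it leaves no room for [bulk]. *)
Definition state3 := [:: 3; 28; 53].

Definition turn3 : seq entry := [::
  (0, None, None,
    [:: [:: 27; 107; 22];
      [:: 84; 19; 29];
      [:: 13; 28; 58]]);
  (1, None, None,
    [:: [:: 14; 101; 59];
      [:: 66; 14; 76];
      [:: 13; 28; 73]]);
  (2, None, None,
    [:: [:: 14; 101; 59];
      [:: 66; 14; 76];
      [:: 13; 28; 73]])].

(** Vertices and edges inside columns use 0, 1, 2; the edges to the next column use 4, then 3, an
    alternation that closes up only after an even number of columns. *)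
Definition pair3 :=
   [:: [:: 29; 59; 14];
      [:: 13; 28; 58]].

Definition state5 := [:: 51; 101; 29; 79; 3].

Definition turn5 : seq entry := [::
  (0, None, None,
    [:: [:: 17; 54; 86; 8; 70];
      [:: 103; 38; 103; 47; 82];
      [:: 51; 111; 29; 84; 23]]);
  (1, None, None,
    [:: [:: 111; 23; 85; 8; 53];
      [:: 85; 45; 58; 102; 47];
      [:: 66; 111; 29; 84; 23]]);
  (2, None, None,
    [:: [:: 7; 110; 23; 77; 66];
      [:: 48; 82; 70; 40; 102];
      [:: 51; 116; 39; 84; 23]]);
  (3, None, None,
    [:: [:: 7; 53; 111; 23; 65];
      [:: 103; 47; 77; 47; 82];
      [:: 51; 116; 29; 84; 23]]);
  (4, None, None,
    [:: [:: 17; 55; 13; 29; 97];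
      [:: 48; 82; 102; 66; 101];
      [:: 51; 116; 29; 89; 23]])].

(** The seam length is congruent to the column length modulo 3, so whole copies of [bulk] fill the
    rest. *)
Definition seam1mod3 := [:: 53].

Definition turn1mod3 : seq entry := [::
  (1, None, None,
    [:: [:: 21; 27; 84; 19; 45; 76; 116];
      [:: 79; 108; 65; 35; 116; 70; 13];
      [:: 58; 22; 82; 117; 22; 82; 102]]);
  (2, None, None,
    [:: [:: 103; 84; 22; 40; 105; 23; 80];
      [:: 14; 28; 116; 71; 86; 45; 58];
      [:: 58; 22; 77; 117; 22; 82; 102]]);
  (3, None, None,
    [:: [:: 40; 21; 28; 107; 95; 8; 95];
      [:: 89; 103; 71; 16; 111; 45; 58];
      [:: 58; 22; 77; 117; 22; 82; 102]]);
  (4, None, None,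
    [:: [:: 45; 80; 103; 84; 22; 28; 116];
      [:: 84; 73; 11; 28; 108; 70; 13];
      [:: 58; 22; 77; 107; 22; 82; 102]]);
  (5, None, None,
    [:: [:: 108; 79; 48; 8; 95; 7; 79];
      [:: 29; 58; 110; 45; 66; 105; 13];
      [:: 58; 22; 82; 117; 22; 82; 102]]);
  (6, None, None,
    [:: [:: 116; 21; 76; 44; 105; 95; 27];
      [:: 85; 103; 69; 11; 44; 59; 23];
      [:: 73; 7; 77; 117; 7; 77; 107]]);
  (0, None, Some 2,
    [:: [:: 7; 79; 108; 23; 28; 108; 95];
      [:: 79; 38; 21; 51; 111; 45; 58];
      [:: 58; 22; 77; 117; 22; 82; 102]]);
  (1, None, Some 4,
    [:: [:: 21; 27; 84; 19; 45; 76; 116; 45; 76; 116];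
      [:: 79; 108; 65; 35; 116; 70; 85; 116; 70; 13];
      [:: 58; 22; 82; 117; 22; 82; 117; 22; 82; 102]]);
  (2, None, Some 3,
    [:: [:: 103; 84; 22; 40; 105; 95; 40; 105; 23; 80];
      [:: 14; 28; 116; 71; 86; 116; 71; 86; 45; 58];
      [:: 58; 22; 77; 117; 22; 77; 117; 22; 82; 102]]);
  (3, None, Some 6,
    [:: [:: 115; 21; 76; 107; 95; 40; 9; 79; 44; 9; 79; 48; 80];
      [:: 86; 103; 69; 21; 66; 111; 76; 66; 11; 28; 58; 110; 48];
      [:: 73; 7; 77; 117; 22; 77; 117; 22; 77; 107; 22; 82; 102]]);
  (4, None, Some 5,
    [:: [:: 29; 84; 103; 84; 22; 28; 116; 21; 28; 116];
      [:: 80; 53; 39; 8; 103; 71; 13; 103; 71; 13];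
      [:: 73; 7; 77; 107; 22; 77; 107; 22; 77; 107]]);
  (5, None, Some 8,
    [:: [:: 115; 9; 103; 48; 80; 102; 44; 9; 95; 40; 105; 23; 80];
      [:: 89; 28; 71; 11; 44; 9; 53; 38; 116; 71; 86; 45; 58];
      [:: 58; 22; 77; 117; 7; 77; 107; 22; 77; 117; 22; 82; 102]]);
  (6, None, Some 7,
    [:: [:: 116; 21; 76; 44; 105; 23; 27; 108; 23; 28; 108; 23; 76];
      [:: 85; 103; 69; 11; 96; 51; 96; 51; 111; 21; 51; 111; 23];
      [:: 73; 7; 77; 117; 22; 77; 117; 22; 77; 117; 22; 77; 107]]);
  (9, Some 2, None,
    [:: [:: 116; 21; 76; 44; 21; 76; 44; 105; 95; 27];
      [:: 85; 103; 69; 11; 79; 69; 11; 44; 59; 23];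
      [:: 73; 7; 77; 117; 7; 77; 117; 7; 77; 107]]);
  (8, Some 1, None,
    [:: [:: 40; 21; 28; 116; 21; 28; 108; 95; 7; 95];
      [:: 89; 103; 71; 13; 103; 71; 11; 116; 45; 58];
      [:: 58; 22; 77; 107; 22; 77; 117; 22; 82; 102]]);
  (10, Some 2, None,
    [:: [:: 21; 76; 108; 23; 28; 108; 23; 40; 105; 79; 47; 76; 116];
      [:: 79; 113; 21; 51; 111; 45; 55; 89; 44; 51; 116; 70; 13];
      [:: 58; 22; 77; 117; 22; 82; 117; 7; 77; 117; 22; 82; 102]]);
  (6, Some 1, None,
    [:: [:: 40; 21; 28; 116; 21; 28; 107; 95; 8; 95];
      [:: 89; 103; 71; 13; 103; 71; 8; 113; 45; 58];
      [:: 58; 22; 77; 107; 22; 77; 107; 22; 82; 102]]);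
  (8, Some 3, None,
    [:: [:: 19; 29; 108; 19; 29; 84; 115; 21; 27; 84; 23; 28; 84];
      [:: 80; 53; 39; 76; 66; 11; 48; 53; 116; 11; 29; 59; 13];
      [:: 73; 7; 77; 117; 22; 77; 107; 22; 77; 117; 7; 77; 107]]);
  (7, Some 2, None,
    [:: [:: 21; 76; 108; 23; 28; 108; 23; 27; 84; 19; 45; 76; 116];
      [:: 79; 113; 21; 51; 111; 21; 51; 116; 55; 85; 116; 70; 13];
      [:: 58; 22; 77; 117; 22; 77; 117; 22; 82; 117; 22; 82; 102]]);
  (9, Some 2, Some 10,
    [:: [:: 116; 21; 76; 44; 21; 76; 44; 101; 96; 27; 108; 23; 28; 108; 23; 76];
      [:: 85; 103; 69; 11; 79; 69; 11; 79; 69; 21; 51; 111; 21; 51; 111; 23];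
      [:: 73; 7; 77; 117; 7; 77; 117; 7; 77; 117; 22; 77; 117; 22; 77; 107]]);
  (7, Some 2, Some 10,
    [:: [:: 21; 76; 108; 23; 28; 108; 23; 27; 84; 19; 45; 80; 115; 45; 76; 116];
      [:: 79; 113; 21; 51; 111; 21; 51; 116; 55; 85; 116; 71; 86; 116; 70; 13];
      [:: 58; 22; 77; 117; 22; 77; 117; 22; 82; 117; 22; 77; 117; 22; 82; 102]]);
  (8, Some 1, Some 11,
    [:: [:: 115; 21; 28; 116; 9; 103; 48; 80; 102; 44; 9; 95; 40; 105; 23; 80];
      [:: 89; 103; 71; 13; 28; 71; 11; 44; 9; 53; 38; 116; 71; 86; 45; 58];
      [:: 58; 22; 77; 107; 22; 77; 117; 7; 77; 107; 22; 77; 117; 22; 82; 102]])].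

Definition seam2mod3 := [:: 29; 77; 4; 102; 27].

Definition turn2mod3 : seq entry := [::
  (0, None, None,
    [:: [:: 51; 116; 51; 44; 21; 76; 116; 9; 79; 48; 16];
      [:: 17; 54; 117; 11; 79; 69; 14; 28; 58; 110; 95];
      [:: 29; 82; 19; 102; 42; 7; 77; 107; 22; 82; 117]]);
  (3, None, None,
    [:: [:: 103; 48; 8; 77; 116; 51; 48; 80; 115; 45; 80];
      [:: 7; 54; 47; 16; 54; 89; 9; 73; 38; 116; 71];
      [:: 29; 82; 19; 102; 42; 7; 77; 107; 22; 77; 117]]);
  (4, None, None,
    [:: [:: 21; 40; 9; 79; 66; 105; 77; 44; 21; 76; 44];
      [:: 117; 59; 77; 66; 14; 84; 19; 51; 89; 19; 51];
      [:: 29; 82; 19; 102; 42; 7; 77; 117; 7; 77; 117]]);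
  (5, None, None,
    [:: [:: 21; 76; 116; 45; 76; 58; 103; 42; 21; 76; 44];
      [:: 117; 54; 97; 66; 14; 101; 71; 76; 69; 14; 76];
      [:: 29; 82; 19; 102; 42; 22; 77; 117; 7; 77; 117]]);
  (6, None, None,
    [:: [:: 29; 108; 79; 44; 21; 28; 58; 19; 51; 84; 19];
      [:: 82; 54; 42; 11; 79; 59; 14; 28; 113; 16; 51];
      [:: 29; 82; 19; 102; 42; 7; 77; 107; 22; 77; 117]]);
  (7, None, None,
    [:: [:: 23; 80; 19; 29; 116; 45; 8; 77; 116; 27; 84];
      [:: 107; 69; 27; 66; 14; 84; 54; 48; 53; 116; 51];
      [:: 29; 82; 19; 102; 42; 7; 77; 107; 22; 77; 117]]);
  (10, None, None,
    [:: [:: 115; 27; 84; 19; 101; 48; 8; 95; 16; 29; 82];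
      [:: 82; 19; 27; 66; 14; 101; 71; 38; 103; 66; 21];
      [:: 29; 82; 19; 102; 42; 22; 77; 107; 22; 77; 117]]);
  (1, None, Some 7,
    [:: [:: 29; 82; 115; 27; 96; 16; 105; 19; 29; 84; 19];
      [:: 82; 19; 47; 16; 54; 89; 44; 51; 86; 16; 51];
      [:: 29; 82; 19; 102; 42; 7; 77; 117; 22; 77; 117]]);
  (2, None, Some 7,
    [:: [:: 21; 40; 55; 103; 42; 9; 103; 44; 21; 76; 44];
      [:: 117; 59; 97; 51; 108; 53; 39; 76; 69; 14; 76];
      [:: 29; 82; 19; 102; 47; 7; 77; 117; 7; 77; 117]]);
  (8, Some 5, None,
    [:: [:: 21; 80; 115; 45; 76; 44; 9; 79; 58; 103; 42];
      [:: 117; 59; 97; 66; 14; 76; 66; 11; 101; 71; 76];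
      [:: 29; 82; 19; 102; 42; 22; 77; 117; 22; 77; 117]]);
  (9, Some 5, None,
    [:: [:: 65; 45; 16; 29; 116; 9; 79; 44; 9; 53; 108];
      [:: 82; 69; 102; 66; 14; 76; 66; 11; 76; 111; 21];
      [:: 29; 82; 19; 102; 42; 22; 77; 117; 22; 77; 117]]);
  (0, None, Some 5,
    [:: [:: 51; 116; 51; 44; 21; 28; 108; 23; 28; 108; 23; 40; 105; 19];
      [:: 117; 54; 117; 11; 79; 111; 21; 51; 111; 45; 55; 89; 44; 51];
      [:: 29; 82; 19; 102; 42; 22; 77; 117; 22; 82; 117; 7; 77; 117]]);
  (3, None, Some 9,
    [:: [:: 103; 48; 8; 77; 116; 51; 48; 80; 115; 45; 80; 115; 45; 80];
      [:: 7; 54; 47; 16; 54; 89; 9; 73; 38; 116; 71; 86; 116; 71];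
      [:: 29; 82; 19; 102; 42; 7; 77; 107; 22; 77; 117; 22; 77; 117]]);
  (4, None, Some 9,
    [:: [:: 45; 80; 19; 29; 82; 115; 51; 44; 21; 76; 44; 21; 80; 115];
      [:: 82; 69; 27; 66; 9; 89; 19; 51; 89; 19; 51; 89; 44; 71];
      [:: 29; 82; 19; 102; 42; 7; 77; 117; 7; 77; 117; 7; 77; 117]]);
  (5, None, Some 10,
    [:: [:: 21; 76; 116; 45; 76; 58; 103; 42; 21; 76; 44; 9; 79; 44];
      [:: 117; 54; 97; 66; 14; 101; 71; 76; 69; 14; 76; 66; 11; 76];
      [:: 29; 82; 19; 102; 42; 22; 77; 117; 7; 77; 117; 22; 77; 117]]);
  (6, None, Some 11,
    [:: [:: 103; 48; 8; 115; 29; 84; 53; 108; 65; 45; 80; 115; 45; 80];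
      [:: 7; 54; 47; 86; 8; 53; 39; 21; 86; 116; 71; 86; 116; 71];
      [:: 29; 82; 19; 102; 47; 7; 77; 117; 22; 77; 117; 22; 77; 117]]);
  (8, Some 5, None,
    [:: [:: 21; 76; 116; 45; 76; 44; 9; 79; 58; 103; 42; 21; 76; 44];
      [:: 117; 54; 97; 66; 14; 76; 66; 11; 101; 71; 76; 69; 14; 76];
      [:: 29; 82; 19; 102; 42; 22; 77; 117; 22; 77; 117; 7; 77; 117]]);
  (9, Some 5, None,
    [:: [:: 96; 40; 9; 79; 116; 21; 76; 44; 9; 53; 44; 55; 19; 101];
      [:: 17; 59; 77; 66; 14; 79; 69; 11; 76; 111; 16; 111; 40; 70];
      [:: 29; 82; 19; 102; 42; 7; 77; 117; 22; 77; 117; 22; 82; 117]]);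
  (10, Some 5, None,
    [:: [:: 76; 116; 21; 28; 116; 21; 76; 44; 9; 79; 66; 105; 77; 48];
      [:: 17; 54; 97; 11; 79; 69; 14; 76; 66; 35; 95; 66; 101; 71];
      [:: 29; 82; 19; 102; 42; 7; 77; 117; 22; 82; 117; 22; 77; 117]]);
  (13, Some 5, None,
    [:: [:: 115; 27; 84; 19; 101; 44; 9; 79; 48; 8; 95; 16; 29; 82];
      [:: 82; 19; 27; 66; 14; 76; 66; 11; 101; 71; 38; 103; 66; 21];
      [:: 29; 82; 19; 102; 42; 22; 77; 117; 22; 77; 107; 22; 77; 117]]);
  (7, None, Some 12,
    [:: [:: 19; 105; 19; 29; 116; 45; 8; 77; 116; 27; 84; 23; 28; 116; 21; 28; 108];
      [:: 82; 69; 27; 66; 14; 84; 54; 48; 53; 116; 51; 111; 21; 53; 113; 21; 51];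
      [:: 29; 82; 19; 102; 42; 7; 77; 107; 22; 77; 117; 22; 77; 107; 22; 77; 117]]);
  (10, Some 5, None,
    [:: [:: 29; 108; 23; 28; 116; 21; 76; 44; 21; 80; 53; 108; 77; 44; 21; 80; 19];
      [:: 82; 54; 47; 11; 79; 69; 14; 76; 69; 39; 21; 51; 116; 51; 89; 44; 51];
      [:: 29; 82; 19; 102; 42; 7; 77; 117; 7; 77; 117; 22; 77; 117; 7; 77; 117]]);
  (8, Some 5, Some 13,
    [:: [:: 21; 80; 115; 45; 76; 44; 9; 79; 58; 103; 42; 21; 76; 44; 9; 79; 44];
      [:: 117; 59; 97; 66; 14; 76; 66; 11; 101; 71; 76; 69; 14; 76; 66; 11; 76];
      [:: 29; 82; 19; 102; 42; 22; 77; 117; 22; 77; 117; 7; 77; 117; 22; 77; 117]]);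
  (9, Some 5, Some 14,
    [:: [:: 103; 48; 16; 29; 116; 21; 76; 44; 9; 77; 108; 65; 45; 80; 115; 45; 80];
      [:: 7; 54; 117; 11; 79; 69; 14; 76; 66; 101; 71; 86; 116; 71; 86; 116; 71];
      [:: 29; 82; 19; 102; 42; 7; 77; 117; 22; 77; 117; 22; 77; 117; 22; 77; 117]]);
  (10, Some 5, Some 15,
    [:: [:: 29; 108; 23; 28; 116; 21; 76; 44; 21; 80; 53; 108; 77; 44; 21; 76; 44; 21; 80; 19];
      [:: 82; 54; 47; 11; 79; 69; 14; 76; 69; 39; 21; 51; 116; 51; 89; 19; 51; 89; 44; 51];
      [:: 29; 82; 19; 102; 42; 7; 77; 117; 7; 77; 117; 22; 77; 117; 7; 77; 117; 7; 77; 117]])].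

(** * From table entries to all lengths and twists *)

Lemma loops_stretched m y y0 c c' l : y <= y0 -> y < m ->
  agrees m (stretch y0 c) c' -> loops y c' (map (stretch y0) l) = loops y c l.
Proof.
move=> le_y lt_ym /agreesP/(_ y lt_ym)/loops_agrees<-; exact: loops_stretch.
Qed.

Definition columns cs : seq (nat -> nat) := [seq nth 0 c | c <- cs].

Definition sound w (e : entry) :=
  let: (t, y1, y2, cs) := e in
  let m := size (head [::] cs) in
  let loop y := loops y (shifted (seam w) m t) (columns cs) in
  [&& size cs == 3, t < m, turn (seam w) m t (columns cs),
      if y1 is Some y then [&& size w <= y, y + 3 <= t & loop y] else true &
      if y2 is Some y then [&& t + size w <= y, y + 3 <= m & loop y] else true].

(* [x] arises from [b] by adding multiples of 3, which is possible if [f]. *)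
Definition fits (f : bool) b x := (x == b) || [&& f, b <= x & x == b %[mod 3]].

(** Here [d] stands for m - t. Repeating rows between the seams changes only [t], repeating rows
    after both seams only [d], so the two are tested independently. *)
Definition covers t d (e : entry) :=
  let: (t0, y1, y2, cs) := e in
  fits (isSome y1) t0 t && fits (isSome y2) (size (head [::] cs) - t0) d.

(** Rows after both seams are inserted first: this does not displace the window at [y1], whereas the
    opposite order would move the one at [y2]. *)
Lemma covers_turn w e t d : sound w e -> covers t d e ->
  exists2 l, size l = 3 & turn (seam w) (t + d) t l.
Proof.
case: e => [[[t0 y1] y2] cs] /and5P[/eqP s3 lt_tm Ht H1 H2] /andP[F1 F2].
set m := size _ in lt_tm Ht H1 H2 F2.
have [j Ej Hj] : exists2 j, d = m - t0 + 3 * j & (isSome y2 || (j == 0)).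
  case/orP: F2 => [/eqP->|/and3P[-> le /eqP eqd]]; first by exists 0; rewrite ?orbT; lia.
  by exists ((d - (m - t0)) %/ 3); rewrite //; lia.
have [i Ei Hi] : exists2 i, t = t0 + 3 * i & (isSome y1 || (i == 0)).
  case/orP: F1 => [/eqP->|/and3P[-> le /eqP eqd]]; first by exists 0; rewrite ?orbT; lia.
  by exists ((t - t0) %/ 3); rewrite //; lia.
have {H2 Hj}[l [sl tl ll]] : exists l, [/\ size l = 3, turn (seam w) (m + 3 * j) t0 l &
    if y1 is Some y then loops y (shifted (seam w) (m + 3 * j) t0) l else true].
  case: y2 H2 Hj {F2} => [y2|] H2 /= Hj; last first.
    exists (columns cs); rewrite (eqP Hj) muln0 addn0 size_map; split=> //.
    by case: y1 H1 {F1 Hi} => // y /and3P[].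
  case/and3P: H2 => le_y2 le_y2m L2 {Ej Hj}.
  (* The induction also carries the loops, which later insertions use again. *)
  suff [l [? ? ? ?]] : exists l, [/\ size l = 3, turn (seam w) (m + 3 * j) t0 l,
      loops y2 (shifted (seam w) (m + 3 * j) t0) l &
      if y1 is Some y then loops y (shifted (seam w) (m + 3 * j) t0) l else true].
    by exists l.
  elim: j => [|j [l [sl tl L2' L1]]].
    exists (columns cs); rewrite muln0 addn0 size_map; split=> //.
    by case: y1 H1 {F1 Hi} => // y /and3P[].
  have lt_tm' : t0 < m + 3 * j by lia.
  have le_m' : y2 + 3 <= m + 3 * j by lia.
  exists (map (stretch y2) l); rewrite size_map mulnS addnCA addnC.
  have Hs := shifted_stretch_after lt_tm' le_y2 le_m'.
  have st y : y <= y2 -> loops y (shifted (seam w) (m + 3 * j + 3) t0) (map (stretch y2) l) =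
      loops y (shifted (seam w) (m + 3 * j) t0) l.
    by move=> le_y; apply: loops_stretched Hs; lia.
  split=> //; first exact: turn_stretch_after; first by rewrite st.
  by case: y1 H1 L1 {F1 Hi} => // y /and3P[_ le_y _] L1; rewrite st //; lia.
rewrite {d F2}Ej {t F1}Ei.
have -> : t0 + 3 * i + (m - t0 + 3 * j) = m + 3 * j + 3 * i by lia.
move: (m + 3 * j) tl ll (leq_trans lt_tm (leq_addr (3 * j) m)) => M tl ll lt_tM.
case: y1 H1 Hi ll => [y|] H1 /= Hi ll; last first.
  by rewrite (eqP Hi) muln0 !addn0; exists l.
case/and3P: H1 => le_y le_yt _ {Hi}.
suff [l' [? ? ?]] : exists l', [/\ size l' = 3, turn (seam w) (M + 3 * i) (t0 + 3 * i) l' &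
    loops y (shifted (seam w) (M + 3 * i) (t0 + 3 * i)) l'] by exists l'.
elim: i => [|i [l' [sl' tl' ll']]]; first by exists l; rewrite muln0 !addn0.
have lt' : t0 + 3 * i < M + 3 * i by lia.
have le' : y + 3 <= t0 + 3 * i by lia.
exists (map (stretch y) l'); rewrite size_map.
have -> : M + 3 * i.+1 = M + 3 * i + 3 by lia.
have -> : t0 + 3 * i.+1 = t0 + 3 * i + 3 by lia.
split=> //; first exact: turn_stretch_before.
by rewrite (loops_stretched _ _ _ (shifted_stretch_before lt' le_y le')) //; lia.
Qed.

(* The tables only contain values below 18, and beyond that being covered depends on
   residues modulo 3 only; modulo 6 keeps track of the parity of t + d as well. *)
Definition clamp x := if x < 18 then x else 18 + x %% 6.

Lemma fits_clamp f b x : b < 18 -> fits f b (clamp x) -> fits f b x.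
Proof.
rewrite /fits /clamp => lt_b; case: ltnP => // le_x.
case/orP=> [/eqP|/and3P[-> _ /eqP eq_b]]; first by lia.
by apply/orP; right; apply/andP; split=> //; apply/andP; split; [lia | apply/eqP; lia].
Qed.

Definition early (e : entry) :=
  let: (t0, _, _, cs) := e in (t0 < 18) && (size (head [::] cs) - t0 < 18).

(** The bound 24 = 18 + 6 exceeds every value of [clamp]. Length 5 is left to [turn5]. *)
Definition complete r tab := all (fun t => all (fun d =>
    [&& 0 < d, 6 < t + d, odd (t + d) & (t + d) %% 3 == r] ==> has (covers t d) tab)
  (iota 0 24)) (iota 0 24).

Lemma table_turn w r tab : all (sound w) tab -> all early tab -> complete r tab ->
  forall m t, 6 < m -> odd m -> m %% 3 = r -> t < m ->
  exists2 l, size l = 3 & turn (seam w) m t l.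
Proof.
move=> /allP Hs /allP He /allP Hc m t lt_6m odd_m mod_m lt_tm.
have lt_c x : clamp x < 24 by rewrite /clamp; case: ifP; lia.
have /allP/(_ (clamp (m - t))) := Hc (clamp t) ltac:(by rewrite mem_iota lt_c).
rewrite mem_iota lt_c => /(_ isT)/implyP Himp.
have /hasP[e e_tab] : has (covers (clamp t) (clamp (m - t))) tab.
  by apply: Himp; apply/and4P; split; rewrite /clamp; do 2?case: ifP; lia.
move: (Hs _ e_tab) (He _ e_tab) => {e_tab}.
case: e => [[[t0 y1] y2] cs] sound_e /andP[lt1 lt2].
case/andP=> /fits_clamp F1 /fits_clamp F2; have -> : m = t + (m - t) by lia.
by apply: (covers_turn sound_e); rewrite /covers F1 ?F2.
Qed.

Lemma turns1mod3 m t : 6 < m -> odd m -> m %% 3 = 1 -> t < m ->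
  exists2 l, size l = 3 & turn (seam seam1mod3) m t l.
Proof. by apply: (@table_turn _ _ turn1mod3); vm_compute. Qed.

Lemma turns2mod3 m t : 6 < m -> odd m -> m %% 3 = 2 -> t < m ->
  exists2 l, size l = 3 & turn (seam seam2mod3) m t l.
Proof. by apply: (@table_turn _ _ turn2mod3); vm_compute. Qed.

Lemma turns5 t : t < 5 -> exists2 l, size l = 3 & turn (seam state5) 5 t l.
Proof.
have: all (sound state5) turn5 && all (fun t => has (covers t (5 - t)) turn5) (iota 0 5).
  by vm_compute.
case/andP=> /allP Hs /allP Hc lt_t5; have /hasP[e e5 cov_e] := Hc t ltac:(by rewrite mem_iota).
by have := covers_turn (Hs e e5) cov_e; rewrite subnKC //; lia.
Qed.

Lemma turns3 t : t < 3 -> exists2 l, size l = 3 & turn (seam state3) 3 t l.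
Proof.
have: all (sound state3) turn3 && all (fun t => has (covers t (3 - t)) turn3) (iota 0 3).
  by vm_compute.
case/andP=> /allP Hs /allP Hc lt_t3; have /hasP[e e3 cov_e] := Hc t ltac:(by rewrite mem_iota).
by have := covers_turn (Hs e e3) cov_e; rewrite subnKC //; lia.
Qed.

(** * Joining blocks of columns and wrapping periodic ones *)

Lemma chain_cat m c l1 l2 :
  chain m c (l1 ++ l2) = chain m c l1 && chain m (last c l1) l2.
Proof. by elim: l1 c => //= d l1 IHl c; rewrite IHl andbA. Qed.

Lemma shifted0 S m : agrees m (shifted S m 0) S.
Proof.
apply/agreesP => y lt_ym; rewrite /shifted subn0 modnDr modn_small //.
by rewrite /same_state !eqxx.
Qed.

Lemma turn_cat S m t l1 l2 :
  turn S m t l1 -> turn S m 0 l2 -> turn S m t (l1 ++ l2).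
Proof.
case/andP=> Hc1 Ha1 /andP[Hc2 Ha2]; rewrite /turn chain_cat Hc1 last_cat /=.
have Ha : agrees m (shifted S m 0) (last (shifted S m t) l1).
  by apply: agrees_trans (shifted0 S m) _; rewrite agrees_sym.
rewrite -(chain_agrees _ Ha) Hc2 /=.
case: l2 Hc2 Ha2 => [_ _ /=|d l2 _] //.
Qed.

(** The twist is absorbed once, by [l1]; the copies of [l2] only add columns. *)
Lemma turn_iter S m t l1 l2 k : turn S m t l1 -> turn S m 0 l2 ->
  exists2 l, size l = size l1 + k * size l2 & turn S m t l.
Proof.
move=> H1 H2; elim: k => [|k [l sl Hl]]; first by exists l1; rewrite // addn0.
by exists (l ++ l2); [rewrite size_cat sl; lia | apply: turn_cat].
Qed.

Definition wrap m (c : nat -> nat) y := c (y %% m).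

Lemma step_wrap m k c d : step m c d -> step (m * k) (wrap m c) (wrap m d).
Proof.
move=> /stepP H; apply/stepP => y lt_y.
have m_gt0 : 0 < m by move: lt_y; case: (m) => //; rewrite mul0n.
have := H (y %% m) (ltn_pmod y m_gt0).
rewrite (@eq_link _ (wrap m c) _ (wrap m d) _ y _ (y.+1 %% (m * k))) // /wrap.
- by rewrite modn_dvdm ?dvdn_mulr // -addn1 modnDml addn1.
- by rewrite modn_dvdm ?dvdn_mulr // -addn1 modnDml addn1.
Qed.

Lemma chain_wrap m k c l :
  chain m c l -> chain (m * k) (wrap m c) (map (wrap m) l).
Proof. by elim: l c => //= d l IHl c /andP[Hs Hc]; rewrite step_wrap ?IHl. Qed.

Lemma agrees_wrap m k c d : agrees m c d -> agrees (m * k) (wrap m c) (wrap m d).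
Proof.
move=> /agreesP H; apply/agreesP => y lt_y; apply: H.
by rewrite ltn_mod; move: lt_y; case: (m) => //; rewrite mul0n.
Qed.

(** A pattern of period [m] sees the twist only modulo [m]. *)
Lemma turn_wrap S m k t l : t < m * k -> turn S m (t %% m) l ->
  turn (wrap m S) (m * k) t (map (wrap m) l).
Proof.
move=> lt_t /andP[Hc Ha].
have m_gt0 : 0 < m by move: lt_t; case: (m) => //; rewrite mul0n.
have Hs : agrees (m * k) (wrap m (shifted S m (t %% m))) (shifted (wrap m S) (m * k) t).
  apply/agreesP => y lt_y; suff -> : wrap m (shifted S m (t %% m)) y = shifted (wrap m S) (m * k) t y.
    by rewrite /same_state !eqxx.
  rewrite /wrap /shifted modn_dvdm ?dvdn_mulr // modnDml; congr S.
  apply/eqP; rewrite eqn_modDl -(eqn_modDr (t %% m)) subnK; last by rewrite ltnW ?ltn_mod.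
  by rewrite modnn modnDmr subnK ?modnMr // ltnW.
rewrite /turn -(chain_agrees _ Hs) chain_wrap //=.
case: l {Hc} Ha => [|d l] Ha /=; last by rewrite last_map agrees_wrap.
by apply: agrees_trans (agrees_wrap k Ha); rewrite agrees_sym.
Qed.

Lemma closed_turn m g t : odd m -> odd g -> 2 < g -> t < m ->
    (3 %| m) || (4 < m) && (3 %| g) ->
  exists S l, size l = g /\ turn S m t l.
Proof.
move=> odd_m odd_g g_gt2 lt_tm.
have [/dvdnP[k def_m] _|m3 /= /andP[m_gt4 /dvdnP[k def_g]]] := boolP (3 %| m).
  rewrite mulnC in def_m; rewrite {}def_m in lt_tm odd_m *.
  have [l1 s1 H1] := turns3 (@ltn_pmod t 3 isT).
  have H2 : turn (seam state3) 3 (0 %% 3) (columns pair3) by vm_compute.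
  have /(turn_wrap lt_tm) {}H1 := H1.
  have /(@turn_wrap _ _ k 0) {}H2 := H2.
  (* Three columns absorb the twist, and pairs make up the rest of the odd number [g]. *)
  have [l sl Hl] := turn_iter ((g - 3) %/ 2) H1 (H2 ltac:(lia)).
  exists (wrap 3 (seam state3)), l; split=> //.
  by rewrite sl !size_map s1 /=; lia.
(* All blocks of three must share one state, whatever their twists, to be concatenated. *)
suff [S H] : exists S, forall u, u < m -> exists2 l, size l = 3 & turn S m u l.
  have [[l1 s1 H1] [l2 s2 H2]] := (H t lt_tm, H 0 ltac:(lia)).
  have [l sl Hl] := turn_iter k.-1 H1 H2.
  by exists S, l; split=> //; rewrite sl s1 s2; lia.
have [->|ne5] := eqVneq m 5; first by exists (seam state5); apply: turns5.
have [mod1|mod1] := eqVneq (m %% 3) 1.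
  by exists (seam seam1mod3) => u; apply: turns1mod3 => //; lia.
by exists (seam seam2mod3) => u; apply: turns2mod3 => //; lia.
Qed.

(** * Colourings of Cayley graphs as functions modulo n *)

(* V x, A x, B x are the colours of the vertex x and of the edges from x to x + a
   and x + b; modulo n, y = x - a and z = x - b. *)
Definition colours5 n a b (V A B : nat -> nat) :=
  (forall x, [/\ V (x %% n) = V x, A (x %% n) = A x & B (x %% n) = B x]) /\
  forall x y z, y + a = x %[mod n] -> z + b = x %[mod n] ->
    [/\ all (gtn 5) [:: V x; A x; B x], uniq [:: V x; A x; A y; B x; B z],
        V x != V y & V x != V z].

Definition colourable5 n a b := exists V A B, colours5 n a b V A B.

Lemma colourable5_swap n a b : colourable5 n a b -> colourable5 n b a.
Proof.
case=> V [A [B [Hp H]]]; exists V, B, A; split=> [x|x y z Hy Hz]; first by case: (Hp x).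
have [/and4P[? ? ? _] Hu ? ?] := H x z y Hz Hy; split=> //; first exact/and4P.
rewrite -(@perm_uniq _ [:: V x; A x; A z; B x; B y]) //.
by apply/permP => p /=; lia.
Qed.

(** Pull the colouring back along multiplication by [u], which carries steps by [a] and [b] to steps
    by [a'] and [b']. *)
Lemma colourable5_scale n u a b a' b' :
    u * a = a' %[mod n] -> u * b = b' %[mod n] ->
  colourable5 n a' b' -> colourable5 n a b.
Proof.
move=> Ha Hb [V [A [B [Hp H]]]]; exists (V \o muln u), (A \o muln u), (B \o muln u).
split=> [x|x y z Hy Hz] /=.
  have E : u * (x %% n) = u * x %[mod n] by rewrite modnMmr.
  have [<- <- <-] := Hp (u * (x %% n)); rewrite E.
  by have [-> -> ->] := Hp (u * x).
apply: H; first by rewrite -modnDmr -Ha modnDmr -mulnDr -modnMmr Hy modnMmr.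
by rewrite -modnDmr -Hb modnDmr -mulnDr -modnMmr Hz modnMmr.
Qed.

Lemma mod_pred n x a : 0 < n -> exists y, y + a = x %[mod n].
Proof.
move=> n_gt0; exists (x + a * n.-1).
by rewrite -addnA addnC -mulnSr prednK // modnMDl.
Qed.

(** As [b'] is -b, the edge from x to x + b' is the old edge starting at x + b'. *)
Lemma colourable5_opp n a b b' : 0 < n -> b + b' = 0 %[mod n] ->
  colourable5 n a b -> colourable5 n a b'.
Proof.
move=> n_gt0 Hb [V [A [B [Hp H]]]]; exists V, A, (fun x => B (x + b')).
have E (f : nat -> nat) x y : (forall x, f (x %% n) = f x) -> x = y %[mod n] -> f x = f y.
  by move=> Hf Exy; rewrite -Hf Exy Hf.
have EB := E B _ _ (fun x => let: And3 _ _ h := Hp x in h).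
split=> [x|x y z Hy Hz]; first have [-> -> _] := Hp x; first split=> //.
  by apply: EB; rewrite modnDml.
have Hxz : x + b = z %[mod n].
  by rewrite -modnDml -Hz modnDml -addnA -modnDmr [b' + b]addnC Hb mod0n addn0.
have Hx : x + b' + b = x %[mod n].
  by rewrite -addnA -modnDmr [b' + b]addnC Hb mod0n addn0.
have [/and4P[Vx Ax Bx _] Hu VVy _] := H x y (x + b') Hy Hx.
have [w Hw] := mod_pred z a n_gt0.
have [_ _ _ VVz] := H z w x Hw Hxz.
have [w' Hw'] := mod_pred (x + b') a n_gt0.
have [|/and4P[_ _ Bx' _] _ _ _] := H (x + b') w' (x + b' + b' ) Hw'.
  by rewrite -addnA -modnDmr [b' + b]addnC Hb mod0n addn0.
split=> //; [exact/and4P | | by rewrite eq_sym].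
rewrite (EB _ _ Hz); move: Hu; rewrite /= !inE !negb_or -!andbA.
by rewrite [B (x + b') == B x]eq_sym => /and5P[-> -> -> -> /and5P[-> -> -> -> /andP[-> ->]]].
Qed.

(** * Column and row coordinates modulo n *)

Lemma nth_chain m c l i : chain m c l -> i < size l ->
  step m (nth c (c :: l) i) (nth c l i).
Proof.
elim: l c i => //= d l IHl c [|i] /andP[Hs Hc] //; rewrite ltnS => lt_i.
by have := IHl d i Hc lt_i; rewrite !(set_nth_default d c) //= ltnW.
Qed.

Lemma colourable5_torus n a b m t S l (I Y : nat -> nat) :
    turn S m t l -> 0 < m -> t < m ->
    (forall x, I x < size l) -> (forall x, Y x < m) ->
    (forall x, I (x %% n) = I x) -> (forall x, Y (x %% n) = Y x) ->
    (forall x, I (x + b) = I x) -> (forall x, Y (x + b) = (Y x).+1 %% m) ->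
    (forall x, (I x).+1 < size l -> I (x + a) = (I x).+1 /\ Y (x + a) = Y x) ->
    (forall x, (I x).+1 = size l -> I (x + a) = 0 /\ Y (x + a) = (Y x + t) %% m) ->
  colourable5 n a b.
Proof.
move=> /andP[Hc /agreesP Ha] m_gt0 lt_tm ltI ltY In Yn Ib Yb Ia Ia'.
pose c x := nth S l (I x) (Y x).
exists (vcol \o c), (ucol \o c), (fcol \o c); split=> [x|x y z Hy Hz].
  by rewrite /= /c In Yn.
have Ex f : (forall x, f (x %% n) = f x) -> f x = f (y + a) :> nat /\ f x = f (z + b).
  by move=> Hf; rewrite -[f x]Hf -Hy Hf -[f (z + b)]Hf Hz -Hy Hf.
have [[Ixy Ixz] [Yxy Yxz]] := (Ex I In, Ex Y Yn).
set s := shifted S m t in Hc.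
have Hstep := nth_chain Hc (ltI x).
move/stepP: Hstep => /(_ (Y z) (ltY z)).
rewrite -Yb -Yxz !(set_nth_default S s) //=; last by rewrite ltnS ltnW.
set e := nth S _ (I x) => Hl.
(* Column 0 is preceded by [s], whose row [Y y + t] is row [Y y] of [S], the state of the last
   column: the twist enters here. *)
have Ec : same_state (e (Y x)) (c y).
  rewrite /e /c; have [lt_y|ge_y] := ltnP (I y).+1 (size l).
    by have [E1 E2] := Ia y lt_y; rewrite Ixy E1 Yxy E2 /= /same_state !eqxx.
  have Esz : (I y).+1 = size l by apply/eqP; rewrite eqn_leq ge_y ltI.
  have [I0 Yt] := Ia' y Esz; rewrite Ixy I0 Yxy Yt /=.
  have -> : s ((Y y + t) %% m) = S (Y y).
    by rewrite /s /shifted modnDml -addnA subnKC 1?ltnW // modnDr modn_small ?ltY.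
  rewrite same_state_sym; have := Ha _ (ltY y).
  by case: (l) Esz => //= d l' [->]; rewrite nth_last.
move: Hl; rewrite (@link_agrees e (fun=> c y) _ _ _ Ec).
case/and3P; rewrite -[nth S l (I x) (Y x)]/(c x) Ixz Ib -[nth S l (I z) (Y z)]/(c z).
move=> Hu Vz Vy; split.
- by rewrite /= /vcol /ucol /fcol !ltn_mod.
- suff Hp : perm_eq [:: vcol (c x); fcol (c z); fcol (c x); ucol (c y); ucol (c x)]
      [:: vcol (c x); ucol (c x); ucol (c y); fcol (c x); fcol (c z)].
    by move: Hu; rewrite (perm_uniq Hp).
  by apply/permP => p /=; lia.
- by rewrite eq_sym.
- by rewrite eq_sym.
Qed.

Lemma eqn_mod_mul2r d k x y : coprime k d ->
  (x * k == y * k %[mod d]) = (x == y %[mod d]).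
Proof.
move=> co_kd; wlog le_yx : x y / y <= x => [IH|].
  by case: (leqP y x) => [/IH//|/ltnW/IH]; rewrite eq_sym => ->; rewrite eq_sym.
by rewrite !eqn_mod_dvd ?leq_mul2r ?le_yx ?orbT // -mulnBl Gauss_dvdl // coprime_sym.
Qed.

Lemma solve_mod n b d : 0 < n -> gcdn n b %| d ->
  exists2 y, y < n %/ gcdn n b & y * b = d %[mod n].
Proof.
move=> n_gt0 /dvdnP[q ->{d}].
have [k _ /dvdnP[r Hr]] := Bezoutl b n_gt0.
set g := gcdn n b in Hr *; have g_gt0 : 0 < g by rewrite gcdn_gt0 n_gt0.
have Hm : n %/ g * g = n by rewrite divnK // dvdn_gcdl.
have m_gt0 : 0 < n %/ g by rewrite divn_gt0 // dvdn_leq // dvdn_gcdl.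
(* Bezout gives [k * b] = -g modulo n, and [n.-1] plays the role of -1. Reducing modulo [n %/ g] is
   harmless since [n %/ g * b] is a multiple of n. *)
exists (k * q * n.-1 %% (n %/ g)); first by rewrite ltn_mod.
have /dvdnP[b' Hb] : g %| b by rewrite dvdn_gcdr.
have Hmod z : (z %% (n %/ g)) * b = z * b %[mod n].
  rewrite [in RHS](divn_eq z (n %/ g)) mulnDl Hb.
  have -> : z %/ (n %/ g) * (n %/ g) * (b' * g) = z %/ (n %/ g) * b' * (n %/ g * g) by lia.
  by rewrite Hm modnMDl.
rewrite Hmod; apply/eqP; rewrite -(eqn_modDr (k * b * q)).
have -> : k * q * n.-1 * b + k * b * q = k * q * b * n.
  by rewrite -[n in RHS](prednK n_gt0); lia.
have -> : q * g + k * b * q = q * r * n by rewrite -[q * r * n]mulnA -Hr; lia.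
by rewrite !modnMl.
Qed.

(** The columns are the cosets of the subgroup generated by [b]. As [a] generates the quotient, each
    x is uniquely [i * a + y * b] with i < g and y < m. *)
Lemma colourable5_rows n a b : odd n -> coprime a (gcdn n b) -> 2 < gcdn n b ->
    (3 %| n %/ gcdn n b) || (4 < n %/ gcdn n b) && (3 %| gcdn n b) ->
  colourable5 n a b.
Proof.
move=> odd_n co_ag g_gt2 H3; have n_gt0 : 0 < n by case: n odd_n {co_ag g_gt2 H3}.
set g := gcdn n b in co_ag g_gt2 H3; set m := n %/ g in H3.
have Hn : n = m * g by rewrite divnK // dvdn_gcdl.
have m_gt0 : 0 < m by rewrite lt0n; apply: contraTneq n_gt0 => m0; rewrite Hn m0.
have /andP[odd_m odd_g] : odd m && odd g by rewrite -oddM -Hn.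
(* After g steps by [a] the initial column is met again, displaced by [t] rows. *)
have [t lt_tm Ht] := solve_mod (d := g * a) n_gt0 (dvdn_mulr a (dvdnn _)).
rewrite -/g -/m in lt_tm.
have [S [l [sl Hl]]] := closed_turn odd_m odd_g g_gt2 lt_tm H3.
have dvd_gb : g %| b by rewrite dvdn_gcdr.
have dvd_gn : g %| n by rewrite dvdn_gcdl.
have co_mb : coprime m (b %/ g).
  rewrite /coprime /m -(@eqn_pmul2r g) ?mul1n ?muln_gcdl; last lia.
  by rewrite !divnK.
have Hmod z : (z %% m) * b = z * b %[mod n].
  rewrite [in RHS](divn_eq z m) mulnDl -{2}(divnK dvd_gb).
  have -> : z %/ m * m * (b %/ g * g) = z %/ m * (b %/ g) * (m * g) by lia.
  by rewrite -Hn modnMDl.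
have modg x y : x = y %[mod n] -> x = y %[mod g].
  by move=> E; rewrite -(modn_dvdm x dvd_gn) E modn_dvdm.
(* Modulo g only [i * a] survives and [a] is invertible, which gives i; then y follows, as [b %/ g]
   is invertible modulo m. *)
have uniqIY i y i' y' : i < g -> i' < g -> y < m -> y' < m ->
    i * a + y * b = i' * a + y' * b %[mod n] -> i = i' /\ y = y'.
  move=> lt_i lt_i' lt_y lt_y' E.
  have b0 z : z * b = 0 %[mod g] by apply/eqP; rewrite mod0n; apply: dvdn_mull.
  have Ei : i = i'.
    have := modg _ _ E; rewrite -modnDmr b0 mod0n addn0 -[in RHS]modnDmr b0 mod0n addn0.
    by move/eqP; rewrite eqn_mod_mul2r // ; rewrite !modn_small // => /eqP.
  split=> //; move: E; rewrite Ei => /eqP; rewrite eqn_modDl.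
  rewrite -(divnK dvd_gb) !mulnA Hn -!muln_modl eqn_pmul2r; last lia.
  by rewrite eqn_mod_mul2r ?[coprime _ m]coprime_sym // !modn_small // => /eqP.
pose P x (p : nat * nat) :=
  [&& p.1 < g, p.2 < m & p.1 * a + p.2 * b == x %[mod n]].
have exP x : exists p, P x p.
  have g_gt0 : 0 < g by lia.
  have co_ga : coprime g a by rewrite coprime_sym.
  have [i lt_i Hi] := solve_mod (b := a) (d := x) g_gt0 ltac:(by rewrite (eqP co_ga) dvd1n).
  rewrite (eqP co_ga) divn1 in lt_i.
  have [|y lt_y Hy] := solve_mod (n := n) (b := b) (d := x + i * a * n.-1) n_gt0.
    rewrite -/g /dvdn -modnDml -Hi modnDml.
    have -> : i * a + i * a * n.-1 = i * a * n by rewrite -mulnS prednK.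
    by apply/eqP/eqP; rewrite Hn mulnA modnMl.
  exists (i, y); rewrite /P lt_i lt_y /=; apply/eqP.
  rewrite -modnDmr Hy modnDmr.
  have -> : i * a + (x + i * a * n.-1) = i * a * n + x.
    by rewrite addnCA -mulnS prednK // addnC.
  by rewrite modnMDl.
pose F x := xchoose (exP x).
have HF x : P x (F x) by apply: xchooseP.
have FP x i y : i < g -> y < m -> i * a + y * b = x %[mod n] -> F x = (i, y).
  move=> lt_i lt_y E; case/and3P: (HF x); case: (F x) => i' y' /= lt_i' lt_y' /eqP E'.
  by have [-> ->] := uniqIY i' y' i y lt_i' lt_i lt_y' lt_y (etrans E' (esym E)).
have FI x : (F x).1 < g by case/and3P: (HF x).
have FY x : (F x).2 < m by case/and3P: (HF x).
have FE x : (F x).1 * a + (F x).2 * b = x %[mod n] by case/and3P: (HF x) => _ _ /eqP.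
have Fn x : F (x %% n) = F x by rewrite [RHS]surjective_pairing; apply: FP; rewrite ?FI ?FY // FE modn_mod.
have Fb x : F (x + b) = ((F x).1, (F x).2.+1 %% m).
  apply: FP; rewrite ?FI ?ltn_mod //.
  by rewrite -modnDmr Hmod modnDmr mulSn addnCA addnC -modnDml FE modnDml.
apply: (@colourable5_torus n a b m t S l (fun x => (F x).1) (fun x => (F x).2)) => //=.
- by move=> x; rewrite sl.
- by move=> x; rewrite Fn.
- by move=> x; rewrite Fn.
- by move=> x; rewrite Fb.
- by move=> x; rewrite Fb.
- move=> x; rewrite sl => lt_F; rewrite (FP _ (F x).1.+1 (F x).2) //.
  by rewrite mulSn -addnA addnC -modnDml FE modnDml.
move=> x; rewrite sl => Eg; rewrite (FP _ 0 (((F x).2 + t) %% m)) ?ltn_mod //; first lia.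
rewrite mul0n add0n Hmod mulnDl -modnDmr Ht modnDmr -Eg mulSn.
by rewrite addnCA [(F x).2 * b + _]addnC addnC -modnDml FE modnDml.
Qed.

(** * Kempe chains in C_n(c, 1) *)

Lemma colourable5_intro n c (V A B : nat -> nat) : 0 < n -> 0 < c < n ->
    (forall x y z, x < n -> y < n -> z < n ->
      y + c = x \/ y + c = x + n -> z + 1 = x \/ z + 1 = x + n ->
      [/\ all (gtn 5) [:: V x; A x; B x], uniq [:: V x; A x; A y; B x; B z],
          V x != V y & V x != V z]) ->
  colourable5 n c 1.
Proof.
move=> n_gt0 /andP[c_gt0 lt_cn] H.
exists (fun x => V (x %% n)), (fun x => A (x %% n)), (fun x => B (x %% n)).
split=> [x|x y z Hy Hz]; first by rewrite modn_mod.
have lt w : w %% n < n by rewrite ltn_mod.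
have step w d : d < n -> w + d = x %[mod n] ->
    w %% n + d = x %% n \/ w %% n + d = x %% n + n.
  move=> lt_d; rewrite -modnDml; move: (lt w) (lt x); move: (w %% n) (x %% n) => w' x' lt_w lt_x.
  have [le_n|lt_n] := leqP n (w' + d); last by rewrite modn_small // => ->; left.
  by rewrite -{1}(subnK le_n) modnDr modn_small => [E|]; [right; rewrite -E subnK | lia].
by apply: H => //; apply: step => //; lia.
Qed.

(* In the next three lemmas the colouring of vertices and c-edges modulo 3 and of
   1-edges modulo 2 only fails at the edge 01, whose neighbouring 1-edges have
   colours 3 and 4.  Recolouring 01 starts a Kempe chain at each of its ends; the
   exceptional values of V, A and B come from swapping these chains, combined in
   the second lemma with an exchange of 3 and 4 along the path from c + 1 to 2c. *)
Lemma colourable5_2mod6 n d : n %% 6 = 3 -> d %% 6 = 2 -> d + 7 <= n -> 2 * d != n + 1 ->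
  colourable5 n d 1.
Proof.
move=> n3 d2 le_dn ne_dn.
(* Edge 01 gets 2. From 0 the chain swaps 2 and 4 on the edges from n - d to 0 and to n - d + 1,
   ending at vertex n - d + 1; from 1 it swaps 2 and 3 on the edges from d + 1 to 1 and to d, ending
   at vertex d. The hypothesis on [2 * d] keeps the two end vertices distinct. *)
pose V x := if x == d then 3 else if x == n - d + 1 then 4 else x %% 3.
pose A x := if x == 1 then 3 else if x == n - d then 4 else x.+1 %% 3.
pose B x := if [|| x == 0, x == d | x == n - d] then 2 else
            if odd x then 4 else 3.
apply: (@colourable5_intro n d V A B); [lia | lia |].
move=> x y z lt_x lt_y lt_z Hy Hz.
(* Every test made by the colouring is reduced to residues, parity and coincidences with special
   points; abstracted to booleans, these leave finitely many cases. *)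
have [[y3 yS3 z3 xS3 odd_z] [y1 yd z0 zd znd] [x01 x0d xnd xyz lt3]] :
    [/\ [/\ y %% 3 = (x %% 3).+1 %% 3, y.+1 %% 3 = (x %% 3).+2 %% 3,
            z %% 3 = (x %% 3).+2 %% 3, x.+1 %% 3 = (x %% 3).+1 %% 3 &
            odd z = (x != 0) && ~~ odd x],
        [/\ (y == 1) = (x == d + 1), (y == n - d) = (x == 0), (z == 0) = (x == 1),
            (z == d) = (x == d + 1) & (z == n - d) = (x == n - d + 1)] &
        [/\ ((x == 0) ==> (x %% 3 == 0) && ~~ odd x) &&
              ((x == 1) ==> [&& x %% 3 == 1, odd x & x != 0]),
            ((x == d) ==> [&& x %% 3 == 2, ~~ odd x, x != 0 & x != 1]) &&
              ((x == d + 1) ==> [&& x %% 3 == 0, odd x, x != 0, x != 1 & x != d]),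
            ((x == n - d) ==> [&& x %% 3 == 1, odd x, x != 0, x != 1, x != d & x != d + 1]) &&
              ((x == n - d + 1) ==> [&& x %% 3 == 2, ~~ odd x, x != 0, x != 1, x != d,
                                        x != d + 1 & x != n - d]),
            [&& ~~ ((x == d) && (y == d)), ~~ ((x == n - d + 1) && (y == n - d + 1)) &
                ~~ ((x == n - d + 1) && (z == n - d + 1))] &
            x %% 3 < 3]].
  by clear V A B; split; split; lia.
rewrite /V /A /B y3 yS3 z3 xS3 odd_z y1 yd z0 zd znd.
move: (x == 0) (x == 1) (x == d) (x == d + 1) (x == n - d) (x == n - d + 1)
  (y == d) (y == n - d + 1) (z == n - d + 1) (odd x) (x %% 3) x01 x0d xnd xyz lt3.
by do 6![case=> //=]; do 4![case=> //=]; case=> [|[|[|]]].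
Qed.

Lemma colourable5_5mod6 n c : n %% 6 = 3 -> c %% 6 = 5 -> 2 * c < n ->
  colourable5 n c 1.
Proof.
move=> n3 c5 lt_cn.
(* Edge 01 gets 1, which moves vertex 1 to colour 3. From 0 the recolouring follows the vertices 0,
   c, c + 1, 2c + 1, 2c and ends by giving vertex 2c colour 4. *)
pose V x := if x == 1 then 3 else if x == 2 * c then 4 else x %% 3.
pose A x := if x == 0 then 4 else if x == c + 1 then 3 else x.+1 %% 3.
pose B x := if [|| x == 0, x == c | x == 2 * c] then 1 else
            if odd x (+) (c < x < 2 * c) then 4 else 3.
apply: (@colourable5_intro n c V A B); [lia | lia |].
move=> x y z lt_x lt_y lt_z Hy Hz.
have [[y3 yS3 z3 xS3 odd_z] [y0 yc z0 zc z2c] [x01 x0c x2c xyz lt3] sz] :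
    [/\ [/\ y %% 3 = (x %% 3).+1 %% 3, y.+1 %% 3 = (x %% 3).+2 %% 3,
            z %% 3 = (x %% 3).+2 %% 3, x.+1 %% 3 = (x %% 3).+1 %% 3 &
            odd z = (x != 0) && ~~ odd x],
        [/\ (y == 0) = (x == c), (y == c + 1) = (x == 2 * c + 1), (z == 0) = (x == 1),
            (z == c) = (x == c + 1) & (z == 2 * c) = (x == 2 * c + 1)],
        [/\ ((x == 0) ==> [&& x %% 3 == 0, ~~ odd x & ~~ (c < x < 2 * c)]) &&
              ((x == 1) ==> [&& x %% 3 == 1, odd x, x != 0 & ~~ (c < x < 2 * c)]),
            ((x == c) ==> [&& x %% 3 == 2, odd x, x != 0, x != 1 & ~~ (c < x < 2 * c)]) &&
              ((x == c + 1) ==> [&& x %% 3 == 0, ~~ odd x, x != 0, x != 1, x != c &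
                                    c < x < 2 * c]),
            ((x == 2 * c) ==> [&& x %% 3 == 1, ~~ odd x, x != 0, x != 1, x != c,
                                    x != c + 1 & ~~ (c < x < 2 * c)]) &&
              ((x == 2 * c + 1) ==> [&& x %% 3 == 2, odd x, x != 0, x != 1, x != c,
                                    x != c + 1, x != 2 * c & ~~ (c < x < 2 * c)]),
            [&& ~~ ((x == 1) && (y == 1)), ~~ ((x == 2 * c) && (y == 2 * c)),
                ~~ ((x == 1) && (z == 1)) & ~~ ((x == 2 * c) && (z == 2 * c))] &
            x %% 3 < 3] &
        (c < z < 2 * c) = (c < x < 2 * c) && (x != c + 1) || (x == 2 * c)].
  by clear V A B; split; [split; lia | split; lia | split; lia | lia].
rewrite /V /A /B y3 yS3 z3 xS3 odd_z y0 yc z0 zc z2c sz.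
rewrite z2c in xyz.
move: (x == 0) (x == 1) (x == c) (x == c + 1) (x == 2 * c) (x == 2 * c + 1)
  (y == 1) (y == 2 * c) (z == 1) (c < x < 2 * c) (odd x) (x %% 3)
  x01 x0c x2c xyz lt3.
by do 6![case=> //=]; do 5![case=> //=]; case=> [|[|[|]]].
Qed.

Lemma colourable5_4mod6 n c : n %% 6 = 3 -> c %% 6 = 4 -> 2 * c + 1 < n ->
  colourable5 n c 1.
Proof.
move=> n3 c4 lt_cn.
(* Edge 01 gets 0, which moves vertex 0 to colour 4. From 1 colours 0 and 3 are swapped along 1, c +
   1, c, 2c, 2c + 1, including the last vertex. *)
pose V x := if x == 0 then 4 else if x == 2 * c + 1 then 3 else x %% 3.
pose A x := if x == 1 then 3 else if x == c then 3 else x.+2 %% 3.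
pose B x := if [|| x == 0, x == c | x == 2 * c] then 0 else
            if odd x then 4 else 3.
apply: (@colourable5_intro n c V A B); [lia | lia |].
move=> x y z lt_x lt_y lt_z Hy Hz.
have [[y3 yS3 z3 xS3 odd_z] [y1 yc z0 zc z2c] [x01 x0c x2c xyz lt3]] :
    [/\ [/\ y %% 3 = (x %% 3).+2 %% 3, y.+2 %% 3 = (x %% 3).+1 %% 3,
            z %% 3 = (x %% 3).+2 %% 3, x.+2 %% 3 = (x %% 3).+2 %% 3 &
            odd z = (x != 0) && ~~ odd x],
        [/\ (y == 1) = (x == c + 1), (y == c) = (x == 2 * c), (z == 0) = (x == 1),
            (z == c) = (x == c + 1) & (z == 2 * c) = (x == 2 * c + 1)] &
        [/\ ((x == 0) ==> (x %% 3 == 0) && ~~ odd x) &&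
              ((x == 1) ==> [&& x %% 3 == 1, odd x & x != 0]),
            ((x == c) ==> [&& x %% 3 == 1, ~~ odd x, x != 0 & x != 1]) &&
              ((x == c + 1) ==> [&& x %% 3 == 2, odd x, x != 0, x != 1 & x != c]),
            ((x == 2 * c) ==> [&& x %% 3 == 2, ~~ odd x, x != 0, x != 1, x != c & x != c + 1]) &&
              ((x == 2 * c + 1) ==> [&& x %% 3 == 0, odd x, x != 0, x != 1, x != c,
                                        x != c + 1 & x != 2 * c]),
            [&& ~~ ((x == 0) && (y == 0)), ~~ ((x == 2 * c + 1) && (y == 2 * c + 1)) &
                ~~ ((x == 2 * c + 1) && (z == 2 * c + 1))] &
            x %% 3 < 3]].
  by clear V A B; split; split; lia.
rewrite /V /A /B y3 yS3 z3 xS3 odd_z y1 yc z0 zc z2c.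
move: (x == 0) (x == 1) (x == c) (x == c + 1) (x == 2 * c) (x == 2 * c + 1)
  (y == 0) (y == 2 * c + 1) (z == 2 * c + 1) (odd x) (x %% 3)
  x01 x0c x2c xyz lt3.
by do 6![case=> //=]; do 4![case=> //=]; case=> [|[|[|]]].
Qed.
(** * From functions modulo n to total colourings *)

Section TotalColoring.
Variable G : sgraph.

(** A vertex and its incident edges conflict pairwise. *)
Lemma colourable_gt_degree k (x : G) :
  total_colorable G k -> #|[set y | adj x y]| < k.
Proof.
case/existsP=> c /forallP Hc.
have {}Hc u v : conflict u v -> c u != c v by move/forallP: (Hc u) => /(_ v)/implyP.
have edge y : adj x y -> [set x; y] \in edges G.
  by move=> xy; apply/imset2P; exists x y => //; rewrite inE.
pose e y : element G := if insub [set x; y] is Some E then inr E else inl x.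
have eE y (xy : adj x y) : e y = inr (exist _ [set x; y] (edge y xy)).
  rewrite /e; case: insubP => [E _ EE|]; last by rewrite edge.
  by congr inr; apply: val_inj.
rewrite -[k]card_ord -[#|'I_k|]cardsT.
rewrite (leq_ltn_trans (_ : _ <= #|[set c (e y) | y in [set y | adj x y]]|)) //.
  rewrite card_in_imset // => y z; rewrite !inE => xy xz Hyz; apply/eqP.
  apply: contraT => ne_yz; suff /Hc : conflict (e y) (e z) by rewrite Hyz eqxx.
  rewrite eE eE /= -val_eqE /=; apply/andP; split; last first.
    by apply/set0Pn; exists x; rewrite !inE eqxx.
  apply: contra ne_yz => /eqP/setP/(_ y); rewrite !inE eqxx orbT => /esym/orP[]/eqP // yx.
  by move: xy; rewrite yx adj_irrefl.
apply: proper_card; apply/properP; split; first exact: subsetT.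
exists (c (inl x)); rewrite ?inE //; apply/imsetP => -[y]; rewrite inE => xy /eqP.
by apply/negP; rewrite eE; apply: Hc; rewrite /= !inE eqxx.
Qed.

Lemma type_I_of_regular d : 0 < #|G| ->
    (forall x : G, #|[set y | adj x y]| = d) -> total_colorable G d.+1 ->
  type_I G /\ total_chromatic_number G = d.+1.
Proof.
move=> /card_gt0P[x0 _] Hd Hc.
have Hchi : total_chromatic_number G = d.+1.
  rewrite /total_chromatic_number; case: ex_minnP => k Hk Hmin; apply/eqP.
  by rewrite eqn_leq Hmin // -(Hd x0) colourable_gt_degree.
split=> //; rewrite /type_I Hchi /max_degree; congr _.+1; apply/eqP.
rewrite eqn_leq -{1}(Hd x0) (leq_bigmax x0) /=.
by apply/bigmax_leqP => x _; rewrite Hd.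
Qed.

Lemma total_colorable_of k (f : G -> nat) (h : {set G} -> nat) :
    (forall x, f x < k.+1) -> (forall E, E \in edges G -> h E < k.+1) ->
    (forall x y, adj x y -> f x != f y) ->
    (forall E x, E \in edges G -> x \in E -> f x != h E) ->
    (forall E F x, E \in edges G -> F \in edges G -> E != F ->
      x \in E -> x \in F -> h E != h F) ->
  total_colorable G k.+1.
Proof.
move=> lt_f lt_h ff fh hh.
pose c (u : element G) : 'I_k.+1 :=
  match u with inl x => Ordinal (lt_f x) | inr E => Ordinal (lt_h _ (valP E)) end.
apply/existsP; exists (finfun c); apply/forallP=> u; apply/forallP=> v; apply/implyP.
rewrite !ffunE; case: u v => [x|E] [y|F] /=.
- exact: ff.
- by move=> xF; rewrite -val_eqE; apply: fh (valP F) xF.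
- by move=> yE; rewrite -val_eqE eq_sym; apply: fh (valP E) yE.
case/andP=> ne_EF /set0Pn[x]; rewrite inE => /andP[xE xF]; rewrite -val_eqE.
exact: hh (valP E) (valP F) ne_EF xE xF.
Qed.

End TotalColoring.

(** * Neighbours and edges of circulant graphs *)

Section CirculantColouring.
Variables (n a b : nat).
Hypotheses (a_gt0 : 0 < a) (lt_ab : a < b) (lt_bn : 2 * b < n).

Let step d (x y : 'I_n) := x + d == y %[mod n].

Lemma stepE d (x y : 'I_n) : d < n -> step d x y = (x + d == y) || (x + d == y + n).
Proof.
move=> lt_d; rewrite /step (modn_small (ltn_ord y)).
have [lt_xd|ge_xd] := ltnP (x + d) n.
  by rewrite modn_small //; have := ltn_ord y; lia.
rewrite -(subnK ge_xd) modnDr modn_small; have := ltn_ord x; have := ltn_ord y; lia.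
Qed.

Definition succ_ord d (x : 'I_n) : 'I_n := Ordinal (ltn_pmod (x + d) (leq_ltn_trans (leq0n x) (ltn_ord x))).

Lemma step_succ d x y : step d x y = (succ_ord d x == y).
Proof. by rewrite -val_eqE /= /step (modn_small (ltn_ord y)). Qed.

Lemma adjE (x y : circulant n [:: a; b]) :
  adj x y = [|| step a x y, step a y x, step b x y | step b y x].
Proof.
rewrite /= /circulant_adj /= orbF.
rewrite ![x == _ %[mod n]]eq_sym -/(step a y x) -/(step b y x) -/(step a x y) -/(step b x y).
rewrite !stepE -?val_eqE /=; have := ltn_ord x; have := ltn_ord y; lia.
Qed.

Lemma step_pred d x y : 0 < d < n -> step d y x = (succ_ord (n - d) x == y).
Proof.
move=> /andP[d_gt0 lt_d]; rewrite -step_succ !stepE //; last by have := ltn_ord x; lia.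
by have := ltn_ord x; have := ltn_ord y; lia.
Qed.

Lemma eq_succ_ord d e x : d < n -> e < n -> (succ_ord d x == succ_ord e x) = (d == e).
Proof. by move=> lt_d lt_e; rewrite -val_eqE /= eqn_modDl !modn_small. Qed.

Definition nbrs (x : 'I_n) :=
  [:: succ_ord a x; succ_ord (n - a) x; succ_ord b x; succ_ord (n - b) x].

(** The four offsets satisfy a < b < n - b < n - a < n. *)
Lemma uniq_nbrs x : uniq (nbrs x).
Proof. by rewrite /= !inE !negb_or !eq_succ_ord; lia. Qed.

Lemma adj_nbrs (x y : circulant n [:: a; b]) : adj x y = (y \in nbrs x).
Proof.
rewrite adjE !step_succ !inE ![y == _]eq_sym -!step_pred ?step_succ //; lia.
Qed.

Lemma circulant_degree (x : circulant n [:: a; b]) : #|[set y | adj x y]| = 4.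
Proof.
rewrite (_ : [set y | adj x y] = [set y in nbrs x]); last first.
  by apply/setP => y; rewrite !inE adj_nbrs !inE.
by rewrite cardsE (card_uniqP (uniq_nbrs x)).
Qed.

Section Colouring.
Variables V A B : nat -> nat.
Hypothesis HVAB : colours5 n a b V A B.

(** The colour is stored at the tail of an edge, recovered by [pick]; the default 0 is never reached
    on an edge. *)
Definition edge_colour (E : {set 'I_n}) : nat :=
  if [pick x in E | [exists y in E, step a x y]] is Some x then A x
  else if [pick x in E | [exists y in E, step b x y]] is Some x then B x else 0.

(** Since d + e is positive and at most 2b < n, no step is the reverse of another: an edge
    determines its tail and its offset. *)
Lemma step_unique d e x y z t : 0 < d <= b -> 0 < e <= b -> step d x y -> step e z t ->
  z \in [set x; y] -> t \in [set x; y] -> z = x /\ d = e.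
Proof.
move=> d_gt0 e_gt0; rewrite !stepE; [|lia..] => xy zt.
have := ltn_ord x; have := ltn_ord y => lt_y lt_x.
by rewrite !inE => /orP[]/eqP Ez /orP[]/eqP Et; subst z t; (split; [|lia]) => //; lia.
Qed.

Lemma edge_colour_a x y : step a x y -> edge_colour [set x; y] = A x.
Proof.
move=> xy; rewrite /edge_colour; case: pickP => [z|/(_ x)/negP[]]; last first.
  by rewrite !inE eqxx; apply/existsP; exists y; rewrite !inE eqxx orbT.
case/andP=> z_xy /existsP[t /andP[t_xy zt]].
by have [|| -> _] := step_unique _ _ xy zt z_xy t_xy; rewrite ?a_gt0 //; lia.
Qed.

Lemma edge_colour_b x y : step b x y -> edge_colour [set x; y] = B x.
Proof.
move=> xy; rewrite /edge_colour; case: pickP => [z|_].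
  case/andP=> z_xy /existsP[t /andP[t_xy zt]].
  by have [|| _ ] := step_unique _ _ xy zt z_xy t_xy; lia.
case: pickP => [z|/(_ x)/negP[]]; last first.
  by rewrite !inE eqxx; apply/existsP; exists y; rewrite !inE eqxx orbT.
case/andP=> z_xy /existsP[t /andP[t_xy zt]].
by have [|| -> _] := step_unique _ _ xy zt z_xy t_xy; lia.
Qed.

(** Listed in the order of [nbrs], so that a neighbour and its edge share an index. *)
Definition nbr_colours (x : 'I_n) :=
  [:: A x; A (succ_ord (n - a) x); B x; B (succ_ord (n - b) x)].

Lemma edge_colour_nbrs x y : y \in nbrs x ->
  edge_colour [set x; y] = nth 0 (nbr_colours x) (index y (nbrs x)).
Proof.
move=> y_x; have := index_uniq (succ_ord a x) _ (uniq_nbrs x).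
move: (y_x); rewrite -index_mem => lt_y; have := nth_index (succ_ord a x) y_x.
case: index lt_y => [|[|[|[|]]]] //= _ <- _.
- by apply: edge_colour_a; rewrite step_succ.
- by rewrite setUC; apply: edge_colour_a; rewrite step_pred //; lia.
- by apply: edge_colour_b; rewrite step_succ.
- by rewrite setUC; apply: edge_colour_b; rewrite step_pred //; lia.
Qed.

Lemma colours_at (x : 'I_n) :
  [/\ V x < 5, all (gtn 5) (nbr_colours x), uniq (V x :: nbr_colours x) &
      forall y : 'I_n, y \in nbrs x -> V x != V y].
Proof.
case: HVAB => Hper H.
have H' (y z w : 'I_n) : step a y z -> step b w z -> _ := fun e1 e2 => H z y w (eqP e1) (eqP e2).
have pa (y : 'I_n) : step a (succ_ord (n - a) y) y by rewrite step_pred //; lia.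
have pb (y : 'I_n) : step b (succ_ord (n - b) y) y by rewrite step_pred //; lia.
have [/and4P[/= V5 A5 B5 _] Hu Va Vb] := H' _ _ _ (pa x) (pb x).
have [/and4P[/= _ A5' _ _] _ _ _] := H' _ _ _ (pa (succ_ord (n - a) x)) (pb _).
have [/and4P[/= _ _ B5' _] _ _ _] := H' _ _ _ (pa (succ_ord (n - b) x)) (pb _).
split=> //; first by rewrite /= A5 A5' B5 B5'.
have sa : step a x (succ_ord a x) by rewrite step_succ.
have sb : step b x (succ_ord b x) by rewrite step_succ.
have [_ _ Vsa _] := H' _ _ _ sa (pb _); have [_ _ _ Vsb] := H' _ _ _ (pa _) sb.
by move=> y; rewrite !inE => /or4P[]/eqP-> //; rewrite eq_sym.
Qed.

Lemma circulant_colourable : total_colorable (circulant n [:: a; b]) 5.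
Proof.
pose C := circulant n [:: a; b].
have lt_E x y : y \in nbrs x -> edge_colour [set x; y] < 5.
  move=> y_x; rewrite edge_colour_nbrs //; have [_ /allP H5 _ _] := colours_at x.
  by apply/H5/mem_nth; rewrite -[size _]/(size (nbrs x)) index_mem.
have edgeP (E : {set C}) (x : C) : E \in edges C -> x \in E ->
    exists2 y, y \in nbrs x & E = [set x; y].
  case/imset2P=> u v _; rewrite inE => /andP[_ uv] ->; rewrite !inE => /orP[]/eqP->.
    by exists v; rewrite -?adj_nbrs.
  by exists u; [rewrite -adj_nbrs (adj_sym (s := C)) | rewrite setUC].
have lt_nbrs x y : y \in nbrs x -> index y (nbrs x) < size (nbr_colours x).
  by rewrite -index_mem.
apply: (@total_colorable_of C 4 (fun x : 'I_n => V x) edge_colour).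
- by move=> x; have [] := colours_at x.
- move=> E E_C; have [x xE] : exists x, x \in E.
    by case/imset2P: E_C => x y _ _ ->; exists x; rewrite !inE eqxx.
  by have [y y_x ->] := edgeP E x E_C xE; apply: lt_E.
- by move=> x y xy; have [_ _ _ HV] := colours_at x; apply: HV; rewrite -adj_nbrs.
- move=> E x E_C xE; have [y y_x ->] := edgeP E x E_C xE.
  have [_ _ /andP[Vn _] _] := colours_at x; apply: contra Vn => /eqP->.
  by rewrite edge_colour_nbrs // mem_nth // lt_nbrs.
move=> E F x E_C F_C ne_EF xE xF.
have [y y_x EE] := edgeP E x E_C xE; have [z z_x FF] := edgeP F x F_C xF.
have [_ _ /andP[_ Hu] _] := colours_at x.
rewrite EE FF !edge_colour_nbrs // nth_uniq ?lt_nbrs //.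
apply: contra ne_EF => /eqP Eyz; rewrite EE FF.
by rewrite -(nth_index x y_x) Eyz nth_index.
Qed.

End Colouring.
End CirculantColouring.

(** * The theorem *)

Lemma colourable5_opp_left n a a' b : 0 < n -> a + a' = 0 %[mod n] ->
  colourable5 n a b -> colourable5 n a' b.
Proof. by move=> n_gt0 Ha /colourable5_swap/(colourable5_opp n_gt0 Ha)/colourable5_swap. Qed.

(** These are the values c = 1/2 and c = -1/2 modulo n: doubling turns the pair (c, 1) into (1, 2)
    or (-1, 2), hence into the case [d] = 2 up to swap and sign. *)
Lemma colourable5_half n c : n %% 6 = 3 -> 3 < n -> 2 * c = n + 1 \/ 2 * c + 1 = n ->
  colourable5 n c 1.
Proof.
move=> n3 n_gt3 Hc; have n_gt0 : 0 < n by lia.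
have H2 : colourable5 n 1 2.
  by apply/colourable5_swap/colourable5_2mod6; lia.
apply: (@colourable5_scale n 2 c 1 (2 * c) 2) => //.
case: Hc => Hc.
  by apply: (@colourable5_scale n 1 _ _ 1 2) H2; rewrite ?mul1n // Hc addnC modnDr.
by apply: colourable5_opp_left H2; rewrite // add1n -addn1 Hc modnn mod0n.
Qed.

Lemma colourable5_1_not3 n c : n %% 6 = 3 -> 1 < c < n - 1 -> c %% 3 != 0 ->
  colourable5 n c 1.
Proof.
move=> n3 lt_c c3; have n_gt0 : 0 < n by lia.
(* Replacing c by n - c exchanges the residues 1 and 2, and 4 and 5, modulo 6; in the latter case
   the smaller of both is chosen. *)
wlog c_mod : c lt_c c3 / c %% 6 = 2 \/ 2 * c < n /\ (c %% 6 = 4 \/ c %% 6 = 5).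
  move=> IH; have [c_mod|c_mod] : (c %% 6 = 2 \/ 2 * c < n /\ (c %% 6 = 4 \/ c %% 6 = 5)) \/
     ((n - c) %% 6 = 2 \/ 2 * (n - c) < n /\ ((n - c) %% 6 = 4 \/ (n - c) %% 6 = 5)) by lia.
    exact: IH.
  apply: (@colourable5_opp_left n (n - c)) => //; last by apply: IH; lia.
  by rewrite subnK ?modnn ?mod0n //; lia.
have [half|not_half] := boolP ((2 * c == n + 1) || (2 * c + 1 == n)).
  by apply: colourable5_half; lia.
case: c_mod => [c2|[lt_cn [c4|c5]]].
(* Here n - c is 1 modulo 6 and greater than 1, hence at least 7. *)
- by apply: colourable5_2mod6; lia.
- by apply: colourable5_4mod6; lia.
- exact: colourable5_5mod6.
Qed.

Lemma colourable5_1 n c : n %% 6 = 3 -> 1 < c < n - 1 -> colourable5 n c 1.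
Proof.
move=> n3 lt_c; have [c3|c3] := eqVneq (c %% 3) 0; last exact: colourable5_1_not3.
have n_gt0 : 0 < n by lia.
have dvd3 : 3 %| gcdn n c by rewrite dvdn_gcd /dvdn c3; lia.
have Hn : n %/ gcdn n c * gcdn n c = n by rewrite divnK // dvdn_gcdl.
have m_neq1 : n %/ gcdn n c != 1.
  apply/eqP => m1; rewrite m1 mul1n in Hn.
  by have := dvdn_leq _ (dvdn_gcdr n c); rewrite Hn; lia.
have odd_m : odd (n %/ gcdn n c).
  have : odd n by lia.
  by rewrite -{1}Hn oddM => /andP[].
apply/colourable5_swap/colourable5_rows; rewrite ?coprime1n //; first by lia.
  by apply: dvdn_leq dvd3; rewrite gcdn_gt0 n_gt0.
rewrite dvd3 andbT; case: (ltnP 4) => [_|]; rewrite ?orbT // => m_le4.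
have -> : n %/ gcdn n c = 3 by move: (n %/ _) odd_m m_neq1 m_le4 => m; lia.
by [].
Qed.

Theorem theorem2p2 (p a b s : nat) (odd_p : odd p)
    (a_ge1 : 1 <= a) (lt_ab : a < b) (b_le : b <= (3 * p - 1) %/ 2)
    (gcd_ab : gcdn a b = 1) (s_gt0 : 0 < s)
    (hs : (3 * p) %/ gcdn (3 * p) b = 3 * s) :
  type_I (circulant (3 * p) [:: a; b]) /\
  total_chromatic_number (circulant (3 * p) [:: a; b]) = 5.
Proof.
have n3 : (3 * p) %% 6 = 3 by lia.
have lt_bn : 2 * b < 3 * p by lia.
move: (3 * p) n3 lt_bn hs {b_le odd_p} => n n3 lt_bn hs.
have n_gt0 : 0 < n by lia.
have [lt_an lt_bn' lt_abn] : [/\ a < n, b < n & a + b < n] by split; lia.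
have col : colourable5 n a b.
  have [g_gt2|g_le2] := ltnP 2 (gcdn n b).
    apply: colourable5_rows => //; first by lia.
      by rewrite /coprime gcdnCA gcd_ab gcdn1.
    by rewrite hs dvdn_mulr.
  have g1 : gcdn n b = 1.
    have g_gt0 : 0 < gcdn n b by rewrite gcdn_gt0 n_gt0.
    case: (gcdn n b) g_le2 g_gt0 (dvdn_gcdl n b) => [|[|[|]]] //; rewrite dvdn2; lia.
  have dvd_g1 : gcdn n b %| 1 by rewrite g1.
  have [u _ Hu] := solve_mod n_gt0 dvd_g1.
  (* [u] is the inverse of [b] modulo n. *)
  apply: (@colourable5_scale n u a b (u * a %% n) 1) => //; first by rewrite modn_mod.
  set c := u * a %% n; have lt_cn : c < n by rewrite ltn_mod.
  have Hc : b * c = a %[mod n].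
    by rewrite modnMmr mulnA [b * u]mulnC -modnMml Hu modnMml mul1n.
  (* The values 0, 1 and -1 of [c] would make [a] congruent to 0, b or -b, against 0 < a < b and a +
     b < n. *)
  have c0 : c != 0.
    by apply: contra_eqN Hc => /eqP->; rewrite muln0 mod0n modn_small // eq_sym -lt0n.
  have c1 : c != 1.
    by apply: contra_eqN Hc => /eqP->; rewrite muln1 !modn_small // neq_ltn lt_ab orbT.
  have cn : c != n - 1.
    apply/eqP => Ec; have : b * c + b = a + b %[mod n] by rewrite -modnDml Hc modnDml.
    rewrite -mulnSr Ec subn1 prednK // modnMl modn_small // => /esym/eqP.
    by rewrite addn_eq0 -leqn0 leqNgt a_ge1.
  by apply: colourable5_1 => //; clear -c0 c1 cn lt_cn; lia.
have [V [A [B HVAB]]] := col.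
have n_card : 0 < #|circulant n [:: a; b]| by rewrite card_ord.
apply: (type_I_of_regular n_card) => [x|]; first exact: circulant_degree.
exact: circulant_colourable HVAB.
Qed.
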